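(* Let $n\in\mathbb N$, let $\psi\colon\mathbb R\to\mathbb R$ be a $C^n$ function whose $n$-th derivative $\psi^{(n)}$ is not identically zero, and let $p\colon\mathbb R^m\to\mathbb R^r$ be a polynomial map of degree at most $n$. Let $\mathcal A=(d_0,\dots,d_k,\psi)$ be a neural network architecture with $d_0=m$, $d_k=r$ and activation function $\psi$, such that there is a hidden layer $0<i<k$ with $d_i\ge r\left(\binom{n+m}{m}-m\right)$, $\min(d_0,\dots,d_{i-1})\ge d_0$, and $\min(d_{i+1},\dots,d_k)\ge d_k$. Then $p$ can be approximated uniformly on compact subsets of $\mathbb R^m$ by responses $\mathcal N^{\mathcal A}_\theta$, $\theta\in\mathbb R^{d(\mathcal A)}$; that is, there is a sequence $(\theta_j)$ in $\mathbb R^{d(\mathcal A)}$ with $\mathcal N^{\mathcal A}_{\theta_j}\to p$ uniformly on compact sets.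
   Context: A neural network architecture is $\mathcal A=(d_0,\dots,d_k,\psi)$ with positive integers $d_i$ and $\psi\colon\mathbb R\to\mathbb R$; $d(\mathcal A)=\sum_{i=1}^kd_i(d_{i-1}+1)$; $\theta\in\mathbb R^{d(\mathcal A)}$ is identified with $(W_1,b_1,\dots,W_k,b_k)$, $W_i\in\mathbb R^{d_i\times d_{i-1}},b_i\in\mathbb R^{d_i}$; the response is $\mathcal N^{\mathcal A}_\theta=f_k\circ\dots\circ f_1\colon\mathbb R^{d_0}\to\mathbb R^{d_k}$ with $f_i(x)=\psi^{(d_i)}(W_ix+b_i)$ for $i<k$ ($\psi$ applied componentwise) and $f_k(x)=W_kx+b_k$. Layers $1,\dots,k-1$ are the hidden layers. *)

(* Defs.v *)
From HB Require Import structures.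
From mathcomp Require Import all_boot all_order all_algebra.
From mathcomp Require Import all_classical all_reals all_analysis.
Set Implicit Arguments. Unset Strict Implicit. Unset Printing Implicit Defensive.
Import Order.TTheory GRing.Theory Num.Theory.
Import numFieldNormedType.Exports.
Local Open Scope ring_scope.

Section Defs.
Variable R : realType.

Definition is_Cn (n : nat) (psi : R -> R) : Prop :=
  (forall k x, (k < n)%N -> derivable (derive1n k psi) x 1) /\
  continuous (derive1n n psi).

Definition poly_fun_le (m n : nat) (f : 'cV[R]_m -> R) : Prop :=
  exists c : {ffun 'I_m -> 'I_n.+1} -> R, forall x : 'cV[R]_m,
    f x = \sum_(a : {ffun 'I_m -> 'I_n.+1} | (\sum_(i < m) (a i : nat) <= n)%N)
            c a * \prod_(i < m) (x i 0) ^+ (a i).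

Definition poly_map_le (m r n : nat) (p : 'cV[R]_m -> 'cV[R]_r) : Prop :=
  forall j : 'I_r, poly_fun_le n (fun x => p x j 0).

(* Parameters of a network with layer widths d : nat -> nat.
   theta i = (W_{i+1}, b_{i+1}) with W_{i+1} : d (i+1) x d i. *)
Definition params (d : nat -> nat) : Type :=
  forall i : nat, 'M[R]_(d i.+1, d i) * 'cV[R]_(d i.+1).

Fixpoint hidden (d : nat -> nat) (psi : R -> R) (theta : params d) (i : nat)
  (x : 'cV[R]_(d 0)) : 'cV[R]_(d i) :=
  match i as i0 return 'cV[R]_(d i0) with
  | 0 => x
  | i'.+1 => map_mx psi ((theta i').1 *m hidden psi theta i' x + (theta i').2)
  end.

Definition response (d : nat -> nat) (k : nat) (psi : R -> R) (theta : params d)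
  (x : 'cV[R]_(d 0)) : 'cV[R]_(d k) :=
  match k as k0 return 'cV[R]_(d k0) with
  | 0 => x
  | k'.+1 => (theta k').1 *m hidden psi theta k' x + (theta k').2
  end.

End Defs.

(* Main.v *)
(* Choose x0 where psi and its first n derivatives are all nonzero.  Near x0 one
   neuron approximates any affine function, hence the layers before and after
   layer i can carry the identity.  In layer i, the degree 2..n part of each
   component of p is matched exactly by sum_l u_l T(x0 + t a_l.x), T being the
   Taylor polynomial of psi: by the multinomial formula this is a linear system
   for u whose matrix is invertible for suitable points a_l, because distinct
   monomials are linearly independent functions.  The weights grow like t^-n
   while the Taylor remainder is o(t^n).  The leftover affine part is unbounded
   as t tends to 0, but t is fixed by then and one more neuron corrects it, which
   gives binom(n + m, m) - 1 - m + 1 neurons per component. *)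
Require Import Defs.
From HB Require Import structures.
From mathcomp Require Import all_boot all_order all_algebra.
From mathcomp Require Import all_classical all_reals all_analysis.
From mathcomp Require Import ring lra zify.
Set Implicit Arguments. Unset Strict Implicit. Unset Printing Implicit Defensive.
Import Order.TTheory GRing.Theory Num.Theory.
Import numFieldNormedType.Exports.
Local Open Scope ring_scope.
Local Open Scope classical_set_scope.

(** * Analysis of the activation: derivatives at one point and Taylor's formula *)

Section Analysis.
Variable R : realType.
Implicit Types f g : R -> R.

(** The endpoints may come in either order, because Taylor increments of both signs occur. *)
Lemma MVT_at f (a b : R) : (forall x, derivable f x 1) ->
  exists2 c, a <= c <= b \/ b <= c <= a & f b - f a = derive1 f c * (b - a).
Proof.
move=> df.
have dfi (x : R) : is_derive x 1 f (derive1 f x).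
  by rewrite derive1E; apply: DeriveDef.
have cf (u v : R) : {within `[u, v], continuous f}.
  apply: continuous_subspaceT => x.
  exact/differentiable_continuous/derivable1_diffP.
have [ab|ba] := leP a b.
  have [c cab e] := MVT_segment ab (fun x _ => dfi x) (cf a b).
  by exists c => //; left; move: cab; rewrite in_itv.
have [c cab e] := MVT_segment (ltW ba) (fun x _ => dfi x) (cf b a).
by exists c; [right; move: cab; rewrite in_itv|lra].
Qed.

(** Descend through the orders, keeping an open interval on which the orders [n - q] to [n] vanish
    nowhere. The next lower order has a nonvanishing derivative there, so if it has a zero [z], the
    mean value theorem makes it nonzero to the right of [z], and the interval is cut at [z]. *)
Lemma exists_nonvanishing_derivatives (n : nat) (psi : R -> R) :
  is_Cn n psi -> (exists x, derive1n n psi x != 0) ->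
  exists x0, forall s, (s <= n)%N -> derive1n s psi x0 != 0.
Proof.
move=> [dpsi cpsi] [x1 nz1].
suff H q : (q <= n)%N -> exists a b : R, a < b /\ forall x, a < x < b ->
    forall s, (n - q <= s <= n)%N -> derive1n s psi x != 0.
  have [a [b [ab h]]] := H n (leqnn n).
  exists ((a + b) / 2) => s sn; apply: h; last by rewrite subnn sn.
  by apply/andP; split; lra.
elim: q => [_|q IH qn].
  have : \forall x \near x1, derive1n n psi x != 0.
    have := cpsi x1; move/cvgr_norm_gt => /(_ 0).
    by rewrite normr_gt0 => /(_ nz1); apply: filterS => x; rewrite normr_gt0.
  move=> /nbhs_ballP[e /= e0 he]; exists (x1 - e), (x1 + e); split; first by lra.
  move=> x xe s; rewrite subn0 -eqn_leq => /eqP <-; apply: he.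
  rewrite /ball /=; rewrite ltr_norml; lra.
have [a [b [ab h]]] := IH (ltnW qn).
set k := (n - q.+1)%N; have kn : (k < n)%N by rewrite /k; lia.
have ek : (n - q = k.+1)%N by rewrite /k; lia.
have [[z zab z0]|nz] := pselect (exists2 z, a < z < b & derive1n k psi z = 0).
  exists z, b; split; first by lra.
  move=> x xzb s /andP[]; rewrite leq_eqVlt => /orP[/eqP <- _|ks sn]; last first.
    by apply: h; [lra|rewrite ek ks].
  have [c cz] := MVT_at z x (fun y => dpsi k y kn).
  rewrite z0 subr0 => ->; apply: mulf_neq0; last by lra.
  rewrite -derive1nS; apply: h; [case: cz; lra|by rewrite ek leqnn].
exists a, b; split=> // x xab s /andP[]; rewrite leq_eqVlt => /orP[/eqP <- _|ks sn].
  by apply/eqP => e; apply: nz; exists x.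
by apply: h; [|rewrite ek ks].
Qed.

(** Induction on [n], starting from continuity. The remainder [g] vanishes at [x0] and its
    derivative is the remainder of [derive1 f] one order lower, so the mean value theorem supplies
    the missing factor [h] with the same [eta] and [delta]. *)
Lemma peano_taylor (n : nat) f (x0 : R) : is_Cn n f ->
  forall eta, 0 < eta -> exists2 delta, 0 < delta & forall h, `|h| <= delta ->
  `|f (x0 + h) - \sum_(s < n.+1) derive1n s f x0 / (s`!)%:R * h ^+ s| <= eta * `|h| ^+ n.
Proof.
elim: n f => [|n IH] f [df cf] eta eta0.
  have /cvgrPdist_le /(_ _ eta0) /nbhs_ballP[e /= e0 he] := cf x0.
  exists (e / 2); first by rewrite divr_gt0.
  move=> h hh; rewrite big_ord_recl big_ord0 /= fact0 !expr0 divr1 !mulr1 addr0.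
  rewrite distrC; apply: he; rewrite /ball /= opprD addNKr normrN; lra.
have df' : is_Cn n (derive1 f).
  by split=> [k x kn|]; rewrite -?derive1Sn //; exact: df.
have [delta d0 hd] := IH _ df' _ eta0; exists delta => // h hh.
pose c s := derive1n s f x0 / (s`!)%:R.
pose P : {poly R} := \poly_(s < n.+2) c s.
pose g y := f y - P.[y - x0].
have dg (y : R) : is_derive y 1 g (derive1 f y - P^`().[y - x0]).
  apply: is_deriveB; first by rewrite derive1E; apply: DeriveDef; first exact: (df 0%N y isT).
  have -> : (fun y => P.[y - x0]) = horner (P \Po ('X - x0%:P)).
    by apply/funext => z; rewrite horner_comp !hornerE.
  suff -> : P^`().[y - x0] = (P \Po ('X - x0%:P))^`().[y] by exact: is_derive_poly.
  by rewrite deriv_comp derivXsubC mulr1 horner_comp !hornerE.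
have dgy y : derivable g y 1 by case: (dg y).
have [y hy] := MVT_at x0 (x0 + h) dgy.
have xh : x0 + h - x0 = h by rewrite addrC addKr.
have gh : g (x0 + h) = f (x0 + h) - \sum_(s < n.+2) c s * h ^+ s.
  by rewrite /g /P xh horner_poly.
have g0 : g x0 = 0.
  rewrite /g subrr horner_poly big_ord_recl big1 => [|i _].
    by rewrite /c /= fact0 expr0 divr1 mulr1 addr0 subrr.
  by rewrite expr0n mulr0.
rewrite g0 subr0 gh xh derive1E => ->.
case: (dg y) => _ ->.
have -> : (deriv P).[y - x0] = \sum_(s < n.+1) derive1n s (derive1 f) x0 / s`!%:R * (y - x0) ^+ s.
  have -> : (deriv P) = \poly_(s < n.+1) (derive1n s (derive1 f) x0 / s`!%:R).
    apply/polyP => s; rewrite coef_deriv !coef_poly ltnS.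
    case: ifP => _; last by rewrite mul0rn.
    rewrite /c derive1Sn factS natrM -mulr_natr; field.
    by rewrite nat1r !pnatr_eq0 -lt0n fact_gt0.
  by rewrite horner_poly.
rewrite normrM exprSr mulrA ler_wpM2r //.
have hy' : `|y - x0| <= `|h|.
  have := ler_norm h; have := ler_norm (- h); rewrite normrN ler_norml.
  by case: hy; lra.
have := hd (y - x0) (le_trans hy' hh); rewrite (addrC x0) subrK => /le_trans; apply.
by rewrite ler_wpM2l ?(ltW eta0) // lerXn2r ?nnegrE.
Qed.

End Analysis.

(** * Linear independence of monomials and interpolation points *)

(** Greedy choice: while fewer than [N] rows are chosen, some nonzero [w] is annihilated by all of
    them. The hypothesis yields [x] with [v x *m w] nonzero, so [v x] lies outside their span. *)
Lemma exists_free_rows (F : fieldType) (T : Type) (N : nat) (v : T -> 'rV[F]_N) :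
  (forall w : 'cV[F]_N, (forall x, v x *m w = 0) -> w = 0) ->
  exists a : 'I_N -> T, row_free (\matrix_i v (a i)).
Proof.
move=> h.
suff H k : (k <= N)%N -> exists a : 'I_k -> T, row_free (\matrix_i v (a i)).
  exact: H.
elim: k => [_|k IH kN].
  by unshelve eexists; [case|rewrite /row_free flatmx0 mxrank0].
have [a fa] := IH (ltnW kN); set A := \matrix_i v (a i) in fa.
have : cokermx A != 0.
  by rewrite -mxrank_eq0 mxrank_coker (eqP fa) subn_eq0 -ltnNge.
move=> nz; have [j wj] : exists j, col j (cokermx A) != 0.
  apply/existsP; apply: contraNT nz; rewrite negb_exists => /forallP z.
  by apply/eqP/matrixP => i j; have /eqP/colP/(_ i) := negPn (z j); rewrite !mxE.
set w := col j _ in wj.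
have Aw : A *m w = 0 by rewrite /w colE mulmxA mulmx_coker mul0mx.
have [x xw] : exists x, v x *m w != 0.
  apply: contrapT => nx; move/eqP: wj; apply; apply: h => x.
  by apply/eqP; apply: contrapT => /negP vx; apply: nx; exists x.
(* The new point takes index [ord0] and the old ones are shifted. Multiplying a linear relation by
   [w] isolates the new coefficient. *)
exists (fun i => oapp a x (unlift ord0 i)); apply: inj_row_free => u u0.
have e : u *m \matrix_i v (oapp a x (unlift ord0 i)) =
    u 0 ord0 *: v x + (\row_i u 0 (lift ord0 i)) *m A.
  rewrite !mulmx_sum_row big_ord_recl rowK unlift_none; congr (_ + _).
  by apply: eq_bigr => i _; rewrite !rowK liftK mxE.
have uz : u 0 ord0 = 0.
  have := congr1 (mulmx^~ w) u0; rewrite e mul0mx mulmxDl -mulmxA Aw mulmx0 addr0.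
  by rewrite -scalemxAl => /eqP; rewrite scaler_eq0 (negPf xw) orbF => /eqP.
move: u0; rewrite e uz scale0r add0r => /eqP; rewrite mulmx_free_eq0 // => /eqP r0.
apply/rowP => i; rewrite mxE; case: (unliftP ord0 i) => [i' ->|-> //].
by have /rowP/(_ i') := r0; rewrite !mxE.
Qed.

Section Monomials.
Variables (R : realFieldType) (m n : nat).
Local Notation expo := {ffun 'I_m -> 'I_n.+1}.

Definition deg (a : expo) : nat := \sum_(i < m) (a i : nat).
Definition mono (x : 'cV[R]_m) (a : expo) : R := \prod_(i < m) (x i 0) ^+ (a i).

(** Remainder and quotient by [B] recover the lowest digit and the number formed by the others. The
    digits are functions on all of [nat] so that the induction can shift them. *)
Lemma base_digits_inj (B k : nat) (f g : nat -> nat) :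
  (forall i, (f i < B)%N) -> (forall i, (g i < B)%N) ->
  (\sum_(i < k) f i * B ^ i = \sum_(i < k) g i * B ^ i)%N ->
  forall i, (i < k)%N -> f i = g i.
Proof.
elim: k f g => // k IH f g fB gB.
have B0 : (0 < B)%N by exact: leq_ltn_trans (fB 0%N).
have step (h : nat -> nat) : (\sum_(i < k.+1) h i * B ^ i =
    (\sum_(i < k) h i.+1 * B ^ i) * B + h 0)%N.
  rewrite big_ord_recl /= expn0 muln1 addnC big_distrl /=; congr addn.
  by apply: eq_bigr => i _; rewrite /bump /= add1n expnSr mulnA.
rewrite !step => e.
have e0 : f 0%N = g 0%N.
  by have := congr1 (modn^~ B) e; rewrite !modnMDl !modn_small.
have eS : (\sum_(i < k) f i.+1 * B ^ i = \sum_(i < k) g i.+1 * B ^ i)%N.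
  by have := congr1 (divn^~ B) e; rewrite !divnMDl // !divn_small // !addn0.
by case=> // i ik; apply: (IH (f \o succn) (g \o succn)) => //= j.
Qed.

(* Kronecker substitution: on the curve x_i = y ^ (n+1)^i distinct monomials
   become distinct powers of y. *)
Lemma monomials_free (c : expo -> R) :
  (forall x, \sum_a c a * mono x a = 0) -> forall a, c a = 0.
Proof.
move=> c0.
pose code (a : expo) : nat := (\sum_(i < m) a i * n.+1 ^ i)%N.
have code_inj : injective code.
  move=> a b e.
  pose ext (u : expo) (i : nat) : nat := oapp (fun j => u j : nat) 0%N (insub i).
  have extE u (i : 'I_m) : ext u i = u i by rewrite /ext valK.
  have extB u i : (ext u i < n.+1)%N by rewrite /ext; case: insub => /=.
  apply/ffunP => i; apply: val_inj => /=; rewrite -!extE.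
  apply: (@base_digits_inj n.+1 m) => //.
  rewrite -[LHS]/(\sum_(j < m) _)%N.
  transitivity (code a); first by apply: eq_bigr => j _; rewrite extE.
  by rewrite e; apply: eq_bigr => j _; rewrite extE.
pose P : {poly R} := \sum_a c a *: 'X^(code a).
have P0 : P = 0.
  apply/eqP; apply/negP => /negP nz.
  (* [P] vanishes at the first [size P] natural numbers, which are more roots than its degree
     allows. *)
  have roots : all (root P) [seq (i%:R : R) | i <- iota 0 (size P)].
    apply/allP => _ /mapP[i _ ->]; apply/rootP.
    rewrite -[RHS](c0 (\col_(j < m) (i%:R ^+ (n.+1 ^ j)))) /P horner_sum.
    apply: eq_bigr => a _; rewrite hornerZ hornerXn; congr (_ * _).
    rewrite /mono /code; under [RHS]eq_bigr do rewrite mxE -exprM.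
    by rewrite prodrXr; congr (_ ^+ _); apply: eq_bigr => j _; rewrite mulnC.
  have := max_poly_roots nz roots; rewrite map_inj_uniq ?iota_uniq.
    by rewrite size_map size_iota ltnn => /(_ isT).
  by move=> i j /eqP; rewrite eqr_nat => /eqP.
move=> a; have := congr1 (fun p : {poly R} => p`_(code a)) P0.
rewrite /P coef0 coef_sum (bigD1 a) //= coefZ coefXn eqxx mulr1 big1 ?addr0 //.
move=> b ba; rewrite coefZ coefXn; case: eqP => [/code_inj e|]; last by rewrite mulr0.
by rewrite e eqxx in ba.
Qed.

(* The multinomial coefficient s! / prod_i a_i!, as the number of words of
   length s in which the letter i occurs a_i times. *)
Definition multi (s : nat) (a : expo) : nat :=
  #|[pred f : {ffun 'I_s -> 'I_m} | [forall i, #|[pred j | f j == i]| == a i]]|.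

(** Writing each letter [i] exactly [a i] times in a row gives such a word. Positivity matters
    because the weights below divide by this number. *)
Lemma multi_gt0 (s : nat) (a : expo) : deg a = s -> (0 < multi s a)%N.
Proof.
move=> das; apply/card_gt0P.
pose l := flatten [seq nseq (a i) i | i <- enum 'I_m].
have szl : size l = s.
  rewrite size_flatten /shape -map_comp sumnE big_map big_enum -das /=.
  by apply: eq_bigr => i _; rewrite size_nseq.
pose t : s.-tuple 'I_m := tcast szl (in_tuple l).
exists [ffun j => tnth t j]; rewrite inE; apply/forallP => i; apply/eqP.
transitivity (count_mem i t).
  rewrite cardE -(map_tnth_enum t) count_map -size_filter enumT.
  by congr size; apply: eq_filter => j; rewrite !inE ffunE.
rewrite val_tcast /= count_flatten -map_comp sumnE big_map big_enum /=.
rewrite (bigD1 i) //= count_nseq /= eqxx mul1n big1 ?addn0 // => j ji.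
by rewrite count_nseq /= (negPf ji).
Qed.

(** The multinomial theorem: expand the power over all words of length [s] and group the words by
    their letter counts. The bound [s <= n] makes these counts fit into ['I_n.+1]. *)
Lemma dot_product_expr (s : nat) (x y : 'cV[R]_m) : (s <= n)%N ->
  (\sum_i x i 0 * y i 0) ^+ s = \sum_(a | deg a == s) (multi s a)%:R * (mono x a * mono y a).
Proof.
move=> sn.
pose cnt (f : {ffun 'I_s -> 'I_m}) : expo := [ffun i => inord #|[pred j | f j == i]|].
have cntE f i : cnt f i = #|[pred j | f j == i]| :> nat.
  rewrite ffunE inordK // ltnS (leq_trans _ sn) //.
  by rewrite -[X in (_ <= X)%N]card_ord max_card.
have degc f : deg (cnt f) = s.
  rewrite /deg; under eq_bigr do rewrite cntE -sum1_card.
  by rewrite -[RHS]card_ord -sum1_card (partition_big f xpredT).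
have powc (f : {ffun 'I_s -> 'I_m}) (z : 'cV[R]_m) : \prod_(j < s) z (f j) 0 = mono z (cnt f).
  rewrite (partition_big f xpredT) //=; apply: eq_bigr => i _.
  rewrite cntE -[RHS]prodr_const; apply: eq_big => [j|j /eqP -> //].
  by rewrite inE.
rewrite -[s in LHS]card_ord -prodr_const bigA_distr_bigA /=.
rewrite (partition_big cnt (fun a => deg a == s)) => [|f _]; last by rewrite degc.
apply: eq_bigr => a _; rewrite /multi -sum1_card natr_sum big_distrl /=.
apply: eq_big => [f|f /eqP <-].
  rewrite inE; apply/eqP/forallP => [<- i|h]; first by rewrite cntE.
  by apply/ffunP => i; apply: val_inj; rewrite /= cntE (eqP (h i)).
by rewrite big_split /= !powc mul1r.
Qed.

Lemma mono_deg0 (x : 'cV[R]_m) (a : expo) : deg a = 0%N -> mono x a = 1.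
Proof.
move=> /eqP; rewrite sum_nat_eq0 => /forallP /= a0.
by rewrite /mono big1 // => i _; rewrite (eqP (a0 i)).
Qed.

Lemma mono_deg1 (x : 'cV[R]_m) (a : expo) : deg a = 1%N ->
  mono x a = \sum_i (a i)%:R * x i 0.
Proof.
move=> a1; have [i ai] : exists i, (0 < a i)%N.
  apply/existsP; rewrite -[X in is_true X]negbK negb_exists; apply/negP => /forallP a0.
  move: a1; rewrite /deg big1 // => i _; apply/eqP.
  by have := a0 i; rewrite -eqn0Ngt.
move: a1; rewrite /deg (bigD1 i) //= => a1.
have ai1 : a i = 1%N :> nat by move: a1 ai; case: (a i : nat) => [|[|k]].
move: a1; rewrite ai1 add1n => -[] /eqP.
rewrite sum_nat_eq0 => /forallP /= a0.
have a0' j : j != i -> a j = 0%N :> nat by move=> ji; apply/eqP/(implyP (a0 j)).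
rewrite /mono (bigD1 i) //= [RHS](bigD1 i) //= ai1 expr1 mul1r !big1 ?mulr1 ?addr0 //.
  by move=> j /a0' ->; rewrite mul0r.
by move=> j /a0' ->; rewrite expr0.
Qed.

(** Independence of the monomials gives points whose evaluation matrix is invertible, and [g] is its
    inverse. Row [j] of [g] is a combination of point evaluations that extracts the coefficient of
    the [j]-th monomial. *)
Lemma exists_interpolation_points (A : {pred expo}) :
  exists (p : 'I_#|A| -> 'cV[R]_m) (g : 'I_#|A| -> 'I_#|A| -> R), forall j j',
    \sum_l g j l * mono (p l) (enum_val j') = (j == j')%:R.
Proof.
pose v x : 'rV[R]_#|A| := \row_j mono x (enum_val j).
have [w w0|p fp] := @exists_free_rows _ _ _ v.
  pose c a := \sum_j (enum_val j == a)%:R * w j 0.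
  have /monomials_free c0 x : \sum_a c a * mono x a = 0.
    have /matrixP/(_ 0 0) := w0 x; rewrite !mxE => e0; rewrite -[RHS]e0.
    rewrite /c; under eq_bigr do rewrite mulr_suml.
    rewrite exchange_big; apply: eq_bigr => j _ /=.
    rewrite (bigD1 (enum_val j)) //= eqxx mul1r mxE mulrC big1 ?addr0 //.
    by move=> a; rewrite eq_sym => /negPf ->; rewrite !mul0r.
  apply/colP => j; rewrite mxE -[RHS](c0 (enum_val j)) /c (bigD1 j) //=.
  rewrite eqxx mul1r big1 ?addr0 // => i ij.
  by rewrite (inj_eq enum_val_inj) (negPf ij) mul0r.
set G := \matrix_i _ in fp.
have uG : G \in unitmx by rewrite -row_free_unit.
exists p, (fun j l => invmx G j l) => j j'.
have /matrixP/(_ j j') := mulVmx uG; rewrite !mxE => <-.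
by apply: eq_bigr => l _; rewrite !mxE.
Qed.

(** At most ['C(n + m, m)] exponents have degree up to [n], and at least [m + 1] of them have degree
    at most 1: zero and the unit vectors. The strict inequality reserves one neuron for the affine
    correction. *)
Lemma card_high_degree : (0 < n)%N ->
  (#|[pred a : expo | 1 < deg a <= n]| < 'C(n + m, m) - m)%N.
Proof.
move=> n0.
have le_bin : (#|[pred a : expo | deg a <= n]| <= 'C(n + m, m))%N.
  rewrite addnC -card_partial_ord_partitions.
  pose f (a : expo) := [tuple a i | i < m].
  have f_inj : injective f.
    move=> a b /(congr1 (fun t => tnth t)) e; apply/ffunP => i.
    by have := congr1 (@^~ i) e; rewrite !tnth_mktuple.
  rewrite -(fintype.card_image f_inj); apply/subset_leq_card/fintype.subsetP => _ /fintype.imageP[a aP ->].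
  by rewrite inE big_tuple; under eq_bigr do rewrite tnth_mktuple.
have ge_low : (m < #|[pred a : expo | deg a <= 1]|)%N.
  pose e (o : option 'I_m) : expo :=
    oapp (fun i : 'I_m => [ffun j => if j == i then inord 1 else ord0]) [ffun=> ord0] o.
  have in1 : (inord 1 : 'I_n.+1) = 1%N :> nat by rewrite inordK.
  have e_inj : injective e.
    move=> [i|] [j|] //= /ffunP.
    - move=> /(_ i); rewrite !ffunE eqxx; case: eqP => [-> //|_ /(congr1 val)].
      by rewrite /= in1.
    - by move=> /(_ i) /(congr1 val); rewrite !ffunE eqxx /= in1.
    - by move=> /(_ j) /(congr1 val); rewrite !ffunE eqxx /= in1.
  have -> : m.+1 = #|{: option 'I_m}| by rewrite card_option card_ord.
  rewrite -(card_codom e_inj); apply/subset_leq_card/fintype.subsetP => _ /codomP[u ->].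
  rewrite inE; case: u => [i|]; rewrite /deg /=.
    rewrite (bigD1 i) //= ffunE eqxx in1 big1 // => j /negPf ji.
    by rewrite ffunE ji.
  by rewrite big1 // => j _; rewrite ffunE.
have eI : #|[predI [pred a | deg a <= n]%N & [pred a : expo | deg a <= 1]%N]|
    = #|[pred a : expo | deg a <= 1]%N|.
  by apply: eq_card => a; rewrite !inE; lia.
have eD : #|[predD [pred a | deg a <= n]%N & [pred a : expo | deg a <= 1]%N]|
    = #|[pred a : expo | 1 < deg a <= n]%N|.
  by apply: eq_card => a; rewrite !inE; lia.
have := cardID [pred a : expo | deg a <= 1]%N [pred a : expo | deg a <= n]%N.
by rewrite eI eD => tot; rewrite ltn_subRL (leq_trans _ le_bin) // -tot ltn_add2r.
Qed.

End Monomials.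

(** * One hidden layer approximating a scalar polynomial *)

Section Shallow.
Variables (R : realType) (psi : R -> R).

Definition inbox m (M : R) (y : 'cV[R]_m) : Prop := forall i, `|y i 0| <= M.

Definition affine m (f : 'cV[R]_m -> R) : Prop :=
  exists (k : R) (l : 'rV[R]_m), forall y, f y = k + (l *m y) 0 0.

Lemma affine_cst m (k : R) : @affine m (fun=> k).
Proof. by exists k, 0 => y; rewrite mul0mx mxE addr0. Qed.

Lemma affine_row m (l : 'rV[R]_m) : affine (fun y => (l *m y) 0 0).
Proof. by exists 0, l => y; rewrite add0r. Qed.

Lemma affineD m (f g : 'cV[R]_m -> R) :
  affine f -> affine g -> affine (fun y => f y + g y).
Proof.
move=> [k [l fE]] [k' [l' gE]]; exists (k + k'), (l + l') => y.
by rewrite fE gE mulmxDl [in RHS]mxE addrACA.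
Qed.

Lemma affineZ m (a : R) (f : 'cV[R]_m -> R) : affine f -> affine (fun y => a * f y).
Proof.
move=> [k [l fE]]; exists (a * k), (a *: l) => y.
by rewrite fE -scalemxAl [in RHS]mxE mulrDr.
Qed.

Lemma affine_sum m (I : finType) (P : pred I) (F : I -> 'cV[R]_m -> R) :
  (forall i, P i -> affine (F i)) -> affine (fun y => \sum_(i | P i) F i y).
Proof.
move=> aF; have [k hk] : exists k, forall i, P i -> exists l : 'rV[R]_m,
    forall y, F i y = k i + (l *m y) 0 0.
  have /choice[k hk] i : exists k, P i -> exists l : 'rV[R]_m,
      forall y, F i y = k + (l *m y) 0 0.
    case: (boolP (P i)) => [/aF[k hk]|]; [by exists k|by exists 0].
  by exists k.
have /choice[l hl] i : exists l : 'rV[R]_m, P i ->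
    forall y, F i y = k i + (l *m y) 0 0.
  case: (boolP (P i)) => [/hk[l hl]|]; [by exists l|by exists 0].
exists (\sum_(i | P i) k i), (\sum_(i | P i) l i) => y.
rewrite mulmx_suml summxE -big_split /=.
by apply: eq_bigr => i Pi; rewrite hl.
Qed.

Lemma row_col_le m (M : R) (l : 'rV[R]_m) (y : 'cV[R]_m) : inbox M y ->
  `|(l *m y) 0 0| <= (\sum_i `|l 0 i|) * M.
Proof.
move=> yM; rewrite mxE mulr_suml (le_trans (ler_norm_sum _ _ _)) //.
by apply: ler_sum => i _; rewrite normrM ler_wpM2l.
Qed.

(* A neuron is a triple (input weights, bias, output weight). *)
Definition shallow m (s : seq ('rV[R]_m * R * R)) (y : 'cV[R]_m) : R :=
  \sum_(t <- s) t.2 * psi ((t.1.1 *m y) 0 0 + t.1.2).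

(** The constant [c] chosen inside is the output bias, so constants cost no neuron. *)
Definition shallow_approx m (N : nat) (f : 'cV[R]_m -> R) : Prop :=
  forall M eps : R, 0 < eps -> exists s c, (size s <= N)%N /\
    forall y, inbox M y -> `|shallow s y + c - f y| < eps.

Lemma is_Cn_le (n k : nat) (f : R -> R) : (k <= n)%N -> is_Cn n f -> is_Cn k f.
Proof.
rewrite leq_eqVlt => /orP[/eqP -> //|kn] [df cf]; split.
  by move=> j x jk; apply/df/(ltn_trans jk).
by move=> x; apply/differentiable_continuous/derivable1_diffP/df.
Qed.

(** The difference quotient [(psi (x0 + t * z) - psi x0) / (c * t)] tends to [z] as [t] tends to 0,
    uniformly for bounded [z]; the output bias takes up [psi x0] and [k]. *)
Lemma shallow_approx_affine m (x0 : R) (f : 'cV[R]_m -> R) : is_Cn 1 psi ->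
  derive1n 1 psi x0 != 0 -> affine f -> shallow_approx 1 f.
Proof.
move=> C1 c0 [k [l fE]] M eps eps0; set c := derive1n 1 psi x0 in c0.
(* [A] bounds the linear part on the box. The absolute value allows a negative [M], and adding 1
   keeps [A] positive. *)
pose A := (\sum_i `|l 0 i|) * `|M| + 1.
have A0 : 0 < A by rewrite ltr_wpDl // mulr_ge0 // sumr_ge0.
(* With this choice the remainder [eta * t * |z|], divided by [|c| * t], is at most [eps / 2]. *)
have eta0 : 0 < eps * `|c| / (2 * A) by rewrite divr_gt0 ?mulr_gt0 // normr_gt0.
have [delta d0 hd] := peano_taylor x0 C1 eta0.
have [t t0 tA] : exists2 t, 0 < t & t * A = delta.
  by exists (delta / A); rewrite ?divr_gt0 // divfK ?gt_eqF.
exists [:: (t *: l, x0, (c * t)^-1)], (k - psi x0 / (c * t)); split=> // y yM.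
rewrite /shallow big_seq1 fE /=.
set z := (l *m y) 0 0.
have -> : ((t *: l) *m y) 0 0 = t * z by rewrite -scalemxAl mxE.
have zA : `|z| <= A.
  rewrite (le_trans (row_col_le l (M := `|M|) _)) ?lerDl //.
  by move=> i; rewrite (le_trans (yM i)) ?ler_norm.
have tz : `|t * z| <= delta.
  by rewrite normrM gtr0_norm // -tA ler_wpM2l // ltW.
have := hd _ tz; rewrite !big_ord_recl big_ord0 /= !fact0 !expr0 divr1 mulr1 addr0.
rewrite /bump /= addn0 factS fact0 mulr1n divr1 !expr1 -/c [x0 + _]addrC => h.
have -> : (c * t)^-1 * psi (t * z + x0) + (k - psi x0 / (c * t)) - (k + z) =
    (psi (t * z + x0) - (psi x0 + c * (t * z))) / (c * t).
  by field; rewrite c0 gt_eqF.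
rewrite normrM normfV ltr_pdivrMr ?normr_gt0 ?mulf_neq0 ?(gt_eqF t0) //.
apply: (le_lt_trans h).
rewrite !normrM (gtr0_norm t0).
have -> : eps * `|c| / (2 * A) * (t * `|z|) = eps * (`|c| * t) * (`|z| / (2 * A)).
  by field; rewrite gt_eqF.
rewrite gtr_pMr ?mulr_gt0 ?normr_gt0 // ltr_pdivrMr ?mulr_gt0 //; lra.
Qed.

Lemma poly_fun_affine_split m n (f : 'cV[R]_m -> R) : poly_fun_le n f ->
  exists (c : {ffun 'I_m -> 'I_n.+1} -> R) (h : 'cV[R]_m -> R), affine h /\
    forall y, f y = h y + \sum_(a in [pred a | 1 < deg a <= n]%N) c a * mono y a.
Proof.
move=> [c fE]; exists c.
exists (fun y => \sum_(a | (deg a <= n)%N && (deg a <= 1)%N) c a * mono y a).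
split=> [|y]; last first.
  rewrite fE (bigID (fun a => (deg a <= 1)%N)) /=; congr (_ + _).
  by apply: eq_bigl => a; rewrite inE -ltnNge andbC.
apply: affine_sum => a /andP[_ a1]; apply: affineZ.
have [a0|a0] := eqVneq (deg a) 0%N.
  rewrite (_ : (fun y => _) = fun=> 1); first exact: affine_cst.
  by apply/funext => y; rewrite mono_deg0.
rewrite (_ : (fun y => _) = fun y => ((\row_i (a i)%:R) *m y) 0 0).
  exact: affine_row.
apply/funext => y; rewrite mono_deg1; last by lia.
by rewrite mxE; apply: eq_bigr => i _; rewrite mxE.
Qed.

(** The multinomial formula applied to each power, regrouped by monomials; degrees 0 and 1 go into
    [h]. Prescribing the coefficients of degree at least 2 thus becomes a linear system in [u]. *)
Lemma ridge_expansion m n (E : nat) (p : 'I_E -> 'cV[R]_m) (u : 'I_E -> R)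
    (D : nat -> R) :
  exists2 h : 'cV[R]_m -> R, affine h & forall y,
    \sum_l u l * (\sum_(s < n.+1) D s * (((p l)^T *m y) 0 0) ^+ s) =
    h y + \sum_(a : {ffun 'I_m -> 'I_n.+1} | a \in [pred a | 1 < deg a <= n]%N)
      D (deg a) * (multi (deg a) a)%:R * (\sum_l u l * mono (p l) a) * mono y a.
Proof.
exists (fun y => \sum_(s < n.+1 | (s <= 1)%N)
   \sum_l u l * (D s * (((p l)^T *m y) 0 0) ^+ s)).
  apply: affine_sum => s s1; apply: affine_sum => l _; do 2!apply: affineZ.
  case: s s1 => -[|[|//]] /= _ _; last exact: affine_row.
  by rewrite (_ : (fun y => _) = fun=> 1); [exact: affine_cst|apply/funext => y].
move=> y; under eq_bigr do rewrite mulr_sumr.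
rewrite exchange_big /= (bigID (fun s : 'I_n.+1 => (s <= 1)%N)) /=; congr (_ + _).
have degI (a : {ffun 'I_m -> 'I_n.+1}) : (deg a <= n)%N ->
  (inord (deg a) : 'I_n.+1) = deg a :> nat by move=> ?; rewrite inordK.
rewrite [RHS](partition_big (fun a => inord (deg a)) (fun s : 'I_n.+1 => (1 < s)%N));
  last by move=> a /andP[a1 an]; rewrite degI.
apply: eq_big => [s|s s1]; first by rewrite ltnNge.
transitivity (\sum_(a : {ffun 'I_m -> 'I_n.+1} | deg a == s)
    \sum_l u l * (D s * ((multi s a)%:R * (mono (p l) a * mono y a)))).
  rewrite exchange_big; apply: eq_bigr => l _ /=; rewrite -mulr_sumr -mulr_sumr.
  rewrite -dot_product_expr; last by rewrite -ltnS.
  by rewrite mxE; under eq_bigr do rewrite mxE.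
apply: eq_big => [a|a /eqP <-].
  rewrite inE; apply/eqP/andP => [as_|[/andP[_ an] /eqP <-]]; last by rewrite degI.
  split; first by rewrite as_ ltnNge s1 -ltnS ltn_ord.
  by apply/eqP/val_inj; rewrite /= inordK // as_.
rewrite mulr_sumr mulr_suml; apply: eq_bigr => l _.
by rewrite !mulrA; do 2!congr (_ * _); rewrite -[LHS]mulrA mulrC.
Qed.

(* The interpolation points give exact weights u(t) for the Taylor polynomial;
   they are O(t^-n), so the o(t^n) Taylor remainder contributes o(1). *)
Lemma high_degree_approx m n (x0 : R) (c : {ffun 'I_m -> 'I_n.+1} -> R)
    (M eps : R) : is_Cn n psi -> (forall s, (s <= n)%N -> derive1n s psi x0 != 0) ->
  0 < eps -> exists s h, [/\ (size s = #|[pred a : {ffun 'I_m -> 'I_n.+1} | 1 < deg a <= n]%N|),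
    affine h & forall y, inbox M y ->
    `|shallow s y - (h y + \sum_(a in [pred a | 1 < deg a <= n]%N) c a * mono y a)| <= eps].
Proof.
move=> Cn nz eps0; set A := [pred a : {ffun 'I_m -> 'I_n.+1} | _].
have [p [g pg]] := exists_interpolation_points R A.
pose C s := derive1n s psi x0 / (s`!)%:R.
have C0 s : (s <= n)%N -> C s != 0.
  by move=> sn; rewrite mulf_neq0 ?nz // invr_eq0 pnatr_eq0 -lt0n fact_gt0.
(* The value that the combination of point evaluations must take at the monomial [a], up to the
   power of [t]. *)
pose K (a : {ffun 'I_m -> 'I_n.+1}) := c a / ((multi (deg a) a)%:R * C (deg a)).
pose e j : {ffun 'I_m -> 'I_n.+1} := @enum_val _ A j.
have eA j : e j \in A by exact: enum_valP.
pose B := \sum_l \sum_j `|g j l * K (e j)|.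
pose Z := (\sum_l (\sum_i `|(p l)^T 0 i|)) * `|M| + 1.
have Z1 : 1 <= Z by rewrite lerDr mulr_ge0 //; do 2!apply: sumr_ge0 => ? _.
have Z0 : 0 < Z by apply: lt_le_trans Z1.
have B0 : 0 <= B by do 2!apply: sumr_ge0 => ? _.
(* Each remainder, after division by [t ^+ n], becomes at most [eps / (B + 1)]; weighted by the
   [|w l|], whose sum is at most [B], they total at most [eps]. *)
have eta0 : 0 < eps / ((B + 1) * Z ^+ n).
  by rewrite divr_gt0 // mulr_gt0 ?exprn_gt0 // ltr_wpDl.
have [delta d0 hd] := peano_taylor x0 Cn eta0.
(* [t <= 1] bounds the weights [w] independently of [t]; [t * Z <= delta] puts every neuron input
   within reach of the Taylor estimate. *)
have [t [t0 t1 tZ]] : exists t : R, [/\ 0 < t, t <= 1 & t * Z <= delta].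
  exists (Num.min 1 (delta / Z)); split.
  - by rewrite lt_min ltr01 divr_gt0.
  - by rewrite ge_min lexx.
  - by rewrite -ler_pdivlMr // ge_min lexx orbT.
(* These are the exact weights multiplied by [t ^+ n]. Since all degrees are at most [n], only
   nonnegative powers of [t] remain. *)
pose w l := \sum_j g j l * (K (e j) * t ^+ (n - deg (e j))).
pose u l := w l / t ^+ n.
have wB : \sum_l `|w l| <= B.
  apply: ler_sum => l _; apply: (le_trans (ler_norm_sum _ _ _)); apply: ler_sum => j _.
  rewrite mulrA normrM ler_piMr // ger0_norm ?exprn_ge0 ?(ltW t0) //.
  by rewrite exprn_ile1 ?(ltW t0).
(* The interpolation identity leaves only the index [j']. The power of [t] in the denominator
   cancels the one in the scaled Taylor coefficient [C s * t ^+ s]. *)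
have uE j' : \sum_l u l * mono (p l) (e j') = K (e j') / t ^+ (deg (e j')).
  transitivity (\sum_j K (e j) * t ^+ (n - deg (e j)) / t ^+ n *
      \sum_l g j l * mono (p l) (e j')).
    under [RHS]eq_bigr do rewrite mulr_sumr.
    rewrite exchange_big; apply: eq_bigr => l _ /=; rewrite /u /w !mulr_suml.
    by apply: eq_bigr => j _; rewrite [RHS]mulrCA -!mulrA.
  under eq_bigr do rewrite pg.
  rewrite (bigD1 j') //= eqxx mulr1 big1 ?addr0 => [|j /negPf ->]; last by rewrite mulr0.
  have /andP[_ en] := eA j'.
  rewrite -mulrA; congr (_ * _); rewrite -[X in _ / t ^+ X](subnK en) exprD invfM.
  by rewrite mulVKf // expf_neq0 // gt_eqF.
have [h ah hE] := @ridge_expansion m n _ p u (fun s => C s * t ^+ s).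
exists [seq (t *: (p l)^T, x0, u l) | l <- enum 'I_#|A|], h; split=> //.
  by rewrite size_map size_enum_ord.
move=> y yM.
have -> : h y + \sum_(a in A) c a * mono y a = \sum_l u l *
     (\sum_(s < n.+1) C s * t ^+ s * (((p l)^T *m y) 0 0) ^+ s).
  rewrite hE; congr (_ + _).
  rewrite [LHS]big_enum_val [RHS]big_enum_val; apply: eq_bigr => j _; congr (_ * _).
  rewrite -/(e j) uE /K; have /andP[_ en] := eA j.
  have simp (a b k x : R) : a != 0 -> b != 0 -> k != 0 -> a * b * k * (x / (k * a) / b) = x.
    by move=> a0 b0 k0; field; rewrite a0 b0 k0.
  by rewrite simp ?C0 // ?pnatr_eq0 -?lt0n ?multi_gt0 // expf_neq0 // gt_eqF.
rewrite /shallow big_map big_enum -sumrB /=.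
have zZ l : `|((p l)^T *m y) 0 0| <= Z.
  rewrite (le_trans (row_col_le (M := `|M|) _ _)) //.
    by move=> i; rewrite (le_trans (yM i)) ?ler_norm.
  rewrite /Z -[X in X <= _]addr0 lerD // ler_wpM2r // (bigD1 l) //=.
  by rewrite lerDl; apply: sumr_ge0 => ? _; apply: sumr_ge0.
apply: (@le_trans _ _ (\sum_l `|w l| * (eps / (B + 1)))).
  apply: (le_trans (ler_norm_sum _ _ _)); apply: ler_sum => l _.
  rewrite -scalemxAl [X in psi (X + _)]mxE /= -mulrBr normrM /u normrM -mulrA ler_wpM2l //.
  set z := ((p l)^T *m y) 0 0.
  have tz : `|t * z| <= delta.
    by rewrite normrM gtr0_norm // (le_trans _ tZ) // ler_wpM2l ?zZ // ltW.
  have := hd _ tz; rewrite [x0 + _]addrC.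
  have -> : \sum_(s < n.+1) derive1n s psi x0 / s`!%:R * (t * z) ^+ s =
      \sum_(s < n.+1) C s * t ^+ s * z ^+ s.
    by apply: eq_bigr => s _; rewrite exprMn mulrA.
  have tn0 : 0 < t ^+ n by rewrite exprn_gt0.
  move=> h1; rewrite normfV (gtr0_norm tn0) ler_pdivrMl // [leRHS]mulrC.
  apply: (le_trans h1).
  rewrite normrM (gtr0_norm t0) exprMn.
  have zn : `|z| ^+ n <= Z ^+ n by rewrite lerXn2r ?nnegrE ?(ltW Z0) // zZ.
  have -> : eps / (B + 1) * t ^+ n = eps / ((B + 1) * Z ^+ n) * (t ^+ n * Z ^+ n).
    have simp (a b x : R) : b != 0 -> eps / a * x = eps / (a * b) * (x * b).
      by move=> b0; rewrite [x * b]mulrC invfM mulrA mulrA mulfVK.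
    by apply: simp; rewrite expf_neq0 // gt_eqF.
  by rewrite ler_wpM2l ?(ltW eta0) // ler_wpM2l ?exprn_ge0 ?(ltW t0).
rewrite -mulr_suml mulrA ler_pdivrMr; last by rewrite ltr_wpDl.
rewrite mulrC ler_wpM2l ?(ltW eps0) //; lra.
Qed.

End Shallow.

(** * From scalar approximation to vector-valued layers and deep networks *)

Section Networks.
Variables (R : realType) (psi : R -> R).

Lemma shallow_approx_poly m n (x0 : R) (f : 'cV[R]_m -> R) : (0 < n)%N ->
  is_Cn n psi -> (forall s, (s <= n)%N -> derive1n s psi x0 != 0) ->
  poly_fun_le n f -> shallow_approx psi ('C(n + m, m) - m) f.
Proof.
move=> n0 Cn nz pf M eps eps0.
have [c [h [ah fE]]] := poly_fun_affine_split pf.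
have e2 : 0 < eps / 2 by rewrite divr_gt0.
have [s [h' [szs ah' hs]]] := high_degree_approx c M Cn nz e2.
(* The leftover affine part depends on the neurons already chosen, so the correcting neuron is
   picked after them. *)
have al : affine (fun y => h y + -1 * h' y) by apply: affineD => //; apply: affineZ.
have [s' [k [szs' hs']]] := shallow_approx_affine (is_Cn_le n0 Cn) (nz 1%N n0) al M e2.
exists (s ++ s'), k; split.
  rewrite size_cat szs (leq_trans (leq_add (leqnn _) szs')) // addn1.
  exact: card_high_degree.
move=> y yM; have := hs y yM; have := hs' y yM.
rewrite fE /shallow big_cat /= -!/(shallow _ _ _).
set S := \sum_(a in _) _; move: (shallow _ s y) (shallow _ s' y) => p q h1 h2.
have -> : p + q + k - (h y + S) = q + k - (h y + -1 * h' y) + (p - (h' y + S)) by ring.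
by rewrite (le_lt_trans (ler_normD _ _)) //; lra.
Qed.

Lemma mxDE p q (A B : 'M[R]_(p, q)) i j : (A + B) i j = A i j + B i j.
Proof. by rewrite mxE. Qed.

Lemma mxBE p q (A B : 'M[R]_(p, q)) i j : (A - B) i j = A i j - B i j.
Proof. by rewrite !mxE. Qed.

Definition shallow_map_approx m r (D : nat) (F : 'cV[R]_m -> 'cV[R]_r) : Prop :=
  forall M eps : R, 0 < eps ->
  exists (W : 'M[R]_(D, m)) (b : 'cV[R]_D) (V : 'M[R]_(r, D)) (c : 'cV[R]_r),
  forall y, inbox M y ->
    inbox eps (V *m map_mx psi (W *m y + b) + c - F y).

(** Each component gets its own block of [N] neurons in the layer, and the output matrix reads row
    [j] from block [j] only. *)
Lemma shallow_map_approx_of_components m r N D (F : 'cV[R]_m -> 'cV[R]_r) :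
  (forall j, shallow_approx psi N (fun y => F y j 0)) -> (r * N <= D)%N -> shallow_map_approx D F.
Proof.
move=> hF rND M eps eps0.
have /choice[S hS] j := hF j M eps eps0.
have /choice[c hc] := hS.
pose T := ('I_r * 'I_N)%type; pose d0 : 'rV[R]_m * R * R := (0, 0, 0).
have leD : (#|{: T}| <= D)%N by rewrite card_prod !card_ord.
pose emb (t : T) : 'I_D := widen_ord leD (enum_rank t).
have emb_inj : injective emb.
  by move=> t t' /(congr1 val) /= /val_inj /enum_rank_inj.
(* A list shorter than [N] is padded by [d0], whose output weight is zero. Neurons outside the image
   of [emb] get an empty sum as output weight. *)
pose nrn (i : 'I_D) := oapp (fun t : T => nth d0 (S t.1) t.2) d0 [pick t | emb t == i].
have nrnE t : nrn (emb t) = nth d0 (S t.1) t.2.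
  by rewrite /nrn; case: pickP => [t' /eqP/emb_inj -> //|/(_ t)]; rewrite eqxx.
exists (\matrix_(i, l) (nrn i).1.1 0 l), (\col_i (nrn i).1.2),
  (\matrix_(j, i) \sum_(t | (emb t == i) && (t.1 == j)) (nrn i).2), (\col_j c j).
move=> y yM j; have [szS /(_ y yM) /ltW] := hc j.
rewrite mxBE mxDE [(\col_i c i) j 0]mxE.
suff -> : shallow psi (S j) y = ((\matrix_(j, i) \sum_(t | (emb t == i) && (t.1 == j)) (nrn i).2)
    *m map_mx psi ((\matrix_(i, l) (nrn i).1.1 0 l) *m y + \col_i (nrn i).1.2)) j 0 by [].
pose G i := (nrn i).2 * psi (((nrn i).1.1 *m y) 0 0 + (nrn i).1.2).
transitivity (\sum_(t : T | t.1 == j) G (emb t)).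
  pose H l := let t := nth d0 (S j) l in t.2 * psi ((t.1.1 *m y) 0 0 + t.1.2).
  have -> : shallow psi (S j) y = \sum_(l < N | (l < size (S j))%N) H l.
    by rewrite -(big_ord_widen _ H szS) /shallow (big_nth d0) big_mkord.
  have -> : \sum_(t : T | t.1 == j) G (emb t) = \sum_(l < N) G (emb (j, l)).
    transitivity (\sum_(i | i == j) \sum_(l < N) G (emb (i, l))).
      by rewrite pair_big; apply: eq_big => [[i l]|[i l] _] //=; rewrite andbT.
    by rewrite big_pred1_eq.
  rewrite [RHS](bigID (fun l : 'I_N => (l < size (S j))%N)) /= [X in _ + X]big1 ?addr0.
    by apply: eq_bigr => l _; rewrite /G nrnE.
  by move=> l; rewrite -leqNgt /G nrnE => /(nth_default d0) ->; rewrite mul0r.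
rewrite (partition_big emb xpredT) // [RHS]mxE; apply: eq_bigr => i _.
rewrite [X in X * _]mxE mulr_suml; apply: eq_big => [t|t /andP[_ /eqP <-]].
  by rewrite andbC.
rewrite /G [in RHS]mxE mxDE [(\col_i _) _ _]mxE; congr (_ * psi (_ + _)).
by rewrite !mxE; apply: eq_bigr => l _; rewrite mxE.
Qed.

Lemma shallow_map_approx_id m D (x0 : R) : is_Cn 1 psi -> derive1n 1 psi x0 != 0 ->
  (m <= D)%N -> shallow_map_approx D (fun y : 'cV[R]_m => y).
Proof.
move=> C1 nz mD; apply: (@shallow_map_approx_of_components _ _ 1); last by rewrite muln1.
move=> j; apply: shallow_approx_affine C1 nz _.
exists 0, (delta_mx 0 j) => y; rewrite add0r mxE (bigD1 j) //= !mxE !eqxx mul1r.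
by rewrite big1 ?addr0 // => i /negPf ij; rewrite mxE ij andbF mul0r.
Qed.

(** One [L] bounds both values and increments on the box, which makes the class stable under
    products. *)
Definition box_lipschitz m (f : 'cV[R]_m -> R) : Prop :=
  forall M, exists2 L, 0 <= L & forall y y' e, 0 <= e -> inbox M y -> inbox M y' ->
    inbox e (y - y') -> `|f y| <= L /\ `|f y - f y'| <= L * e.

Lemma box_lipschitz_cst m (k : R) : box_lipschitz (fun _ : 'cV[R]_m => k).
Proof.
by move=> B; exists `|k| => // y y' e e0 _ _ _; rewrite subrr normr0 mulr_ge0.
Qed.

Lemma box_lipschitz_coord m i : box_lipschitz (fun y : 'cV[R]_m => y i 0).
Proof.
move=> B; exists (`|B| + 1); first by rewrite addr_ge0.
move=> y y' e e0 yB y'B /(_ i); rewrite mxBE => ye; split.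
  by have := yB i; have := ler_norm B; lra.
by rewrite (le_trans ye) // mulrDl mul1r lerDr mulr_ge0.
Qed.

Lemma box_lipschitzD m (f g : 'cV[R]_m -> R) :
  box_lipschitz f -> box_lipschitz g -> box_lipschitz (fun y => f y + g y).
Proof.
move=> lf lg B; have [L L0 h] := lf B; have [L' L0' h'] := lg B.
exists (L + L'); first by rewrite addr_ge0.
move=> y y' e e0 yB y'B ye; have [a b] := h _ _ _ e0 yB y'B ye.
have [a' b'] := h' _ _ _ e0 yB y'B ye; split.
  by rewrite (le_trans (ler_normD _ _)) // lerD.
by rewrite opprD addrACA (le_trans (ler_normD _ _)) // mulrDl lerD.
Qed.

Lemma box_lipschitzM m (f g : 'cV[R]_m -> R) :
  box_lipschitz f -> box_lipschitz g -> box_lipschitz (fun y => f y * g y).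
Proof.
move=> lf lg B; have [L L0 h] := lf B; have [L' L0' h'] := lg B.
have LL0 : 0 <= L * L' by rewrite mulr_ge0.
exists (L * L' + L * L'); first by rewrite addr_ge0.
move=> y y' e e0 yB y'B ye; have [a b] := h _ _ _ e0 yB y'B ye.
have [a' b'] := h' _ _ _ e0 yB y'B ye.
(* Comparing [y'] with itself gives the bound on [g y'] that the product rule below uses. *)
have [|a'' _] := h' y' y' e e0 y'B y'B; first by move=> i; rewrite subrr mxE normr0.
split; first by rewrite normrM (le_trans (ler_pM _ _ a a')) // lerDl.
have -> : f y * g y - f y' * g y' = f y * (g y - g y') + (f y - f y') * g y' by ring.
rewrite (le_trans (ler_normD _ _)) // !normrM mulrDl; apply: lerD.
  by rewrite -mulrA ler_pM.
by rewrite mulrAC ler_pM // mulr_ge0.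
Qed.

Lemma box_lipschitz_sum m (I : Type) (r : seq I) (P : pred I) (F : I -> 'cV[R]_m -> R) :
  (forall i, box_lipschitz (F i)) -> box_lipschitz (fun y => \sum_(i <- r | P i) F i y).
Proof.
move=> lF; elim: r => [|i r IH].
  under eq_fun do rewrite big_nil; exact: box_lipschitz_cst.
under eq_fun do rewrite big_cons; case: (P i) => //; exact: box_lipschitzD.
Qed.

Lemma box_lipschitz_prod m (I : Type) (r : seq I) (F : I -> 'cV[R]_m -> R) :
  (forall i, box_lipschitz (F i)) -> box_lipschitz (fun y => \prod_(i <- r) F i y).
Proof.
move=> lF; elim: r => [|i r IH].
  under eq_fun do rewrite big_nil; exact: box_lipschitz_cst.
under eq_fun do rewrite big_cons; exact: box_lipschitzM.
Qed.

Lemma box_lipschitz_poly m n (f : 'cV[R]_m -> R) : poly_fun_le n f -> box_lipschitz f.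
Proof.
move=> [c fE]; rewrite (funext fE); apply: box_lipschitz_sum => a.
apply: box_lipschitzM; first exact: box_lipschitz_cst.
apply: box_lipschitz_prod => i; elim: (a i : nat) => [|k IH].
  under eq_fun do rewrite expr0; exact: box_lipschitz_cst.
under eq_fun do rewrite exprS; apply: box_lipschitzM => //.
exact: box_lipschitz_coord.
Qed.

Lemma hidden_ext (d : nat -> nat) (th th' : params R d) (l : nat) x :
  (forall i, (i < l)%N -> th i = th' i) -> hidden psi th l x = hidden psi th' l x.
Proof.
elim: l => //= l IH h; rewrite h // IH // => i il; apply: h.
exact: ltn_trans il _.
Qed.

(* Every network prefix is read through an affine map (A, c), which is absorbed
   either by the next hidden layer or by the output layer. *)
Definition prefix_approx (d : nat -> nat) (l s : nat) (g : 'cV[R]_(d 0%N) -> 'cV[R]_s) :=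
  forall M eps : R, 0 < eps ->
  exists (th : params R d) (A : 'M[R]_(s, d l)) (c : 'cV[R]_s),
  forall x, inbox M x -> inbox eps (A *m hidden psi th l x + c - g x).

(** The new layer is compared with [F] at the input [y] that it really receives, and the Lipschitz
    bound of [F] then passes from [y] to [g x]. Each of the two errors is at most [eps / 2]. *)
Lemma prefix_approx_step d l s s' (g : 'cV[R]_(d 0%N) -> 'cV[R]_s) (F : 'cV[R]_s -> 'cV[R]_s') :
  prefix_approx l g -> (forall M, exists B, forall x, inbox M x -> inbox B (g x)) ->
  shallow_map_approx (d l.+1) F -> (forall j, box_lipschitz (fun y => F y j 0)) ->
  prefix_approx l.+1 (F \o g).
Proof.
move=> lg bg vF lF M eps eps0.
(* The margin 1 keeps the perturbed input [y] in the box as well, since [e <= 1]. *)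
have [B0 gB0] := bg M; pose B := B0 + 1.
have e2 : 0 < eps / 2 by rewrite divr_gt0.
have [W [b [V [c vFE]]]] := vF B _ e2.
have /choice[L hL] j : exists L, 0 <= L /\ forall y y' e, 0 <= e -> inbox B y ->
    inbox B y' -> inbox e (y - y') -> `|F y j 0| <= L /\ `|F y j 0 - F y' j 0| <= L * e.
  by have [L L0 h] := lF j B; exists L.
pose K := \sum_j L j + 1.
have LK j : L j <= K.
  rewrite /K (bigD1 j) //= -addrA lerDl addr_ge0 // sumr_ge0 // => i _.
  by case: (hL i).
have K0 : 0 < K.
  by rewrite ltr_wpDl // sumr_ge0 // => i _; case: (hL i).
pose e := Num.min 1 (eps / (2 * K)).
have e0 : 0 < e by rewrite lt_min ltr01 divr_gt0 // mulr_gt0.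
have [th [A [a hth]]] := lg M _ e0.
(* The old read-out [(A, a)] is merged into the weights of the new layer, and [(V, c)] is the new
   read-out. *)
exists (dfwith th l (W *m A, W *m a + b)), V, c => x xM.
rewrite /= dfwithin /= (@hidden_ext _ _ th); last first.
  by move=> i il; rewrite dfwithout // neq_ltn il orbT.
rewrite -mulmxA addrA -mulmxDr.
set y := _ + a; have ye : inbox e (y - g x) := hth _ xM.
have gB : inbox B (g x) by move=> i; rewrite (le_trans (gB0 x xM i)) // lerDl.
have yB : inbox B y.
  move=> i; rewrite -[y](subrK (g x)) mxDE (le_trans (ler_normD _ _)) // addrC lerD ?gB0 //.
  by rewrite (le_trans (ye i)) // ge_min lexx.
move=> j; have := vFE y yB j; rewrite !mxBE /comp => h1.
have [_ /(_ y (g x) e (ltW e0) yB gB ye) [_ h2]] := hL j.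
have h3 : L j * e <= eps / 2.
  rewrite (le_trans (ler_wpM2r (ltW e0) (LK j))) // mulrC -ler_pdivlMr //.
  have -> : eps / 2 / K = eps / (2 * K) by rewrite invfM mulrA.
  by rewrite ge_min lexx orbT.
rewrite -[X in X - _](subrK (F y j 0)) -addrA (le_trans (ler_normD _ _)) //.
lra.
Qed.

Lemma poly_map_bounded m r n (F : 'cV[R]_m -> 'cV[R]_r) : poly_map_le n F ->
  forall M, exists B, forall x, inbox M x -> inbox B (F x).
Proof.
move=> pF M.
have /choice[L hL] j : exists L, 0 <= L /\ forall x, inbox M x -> `|F x j 0| <= L.
  have [L L0 h] := box_lipschitz_poly (pF j) M; exists L; split=> // x xM.
  by have [] // := h x x 0 (lexx _) xM xM; move=> i; rewrite subrr mxE normr0.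
exists (\sum_j L j) => x xM j; rewrite (bigD1 j) //=.
have [_ /(_ x xM) h] := hL j; rewrite (le_trans h) // lerDl.
by apply: sumr_ge0 => i _; case: (hL i).
Qed.

(** The layers before [i] carry the input, layer [i] computes [p], and the later hidden layers carry
    its value; the width assumptions give each of them enough neurons. *)
Lemma network_approx (d : nat -> nat) (n i k : nat) (p : 'cV[R]_(d 0%N) -> 'cV[R]_(d k)) :
  (0 < n)%N -> is_Cn n psi -> (exists x, derive1n n psi x != 0) -> poly_map_le n p ->
  (0 < i < k)%N -> (d k * ('C(n + d 0, d 0) - d 0) <= d i)%N ->
  (forall l, (l < i)%N -> (d 0 <= d l)%N) ->
  (forall l, (i < l <= k)%N -> (d k <= d l)%N) ->
  prefix_approx k.-1 p.
Proof.
move=> n0 Cn ex pp /andP[i0 ik] di dlo dhi.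
have [x0 nz] := exists_nonvanishing_derivatives Cn ex.
have C1 := is_Cn_le n0 Cn; have nz1 := nz 1%N n0.
have lip_id s : forall j, box_lipschitz (fun y : 'cV[R]_s => y j 0).
  exact: box_lipschitz_coord.
have lo l : (l < i)%N -> prefix_approx l (fun x : 'cV[R]_(d 0%N) => x).
  elim: l => [_|l IH li].
    move=> M eps eps0; exists (fun=> (0, 0)), 1%:M, 0 => x _ j /=.
    by rewrite mul1mx addr0 subrr mxE normr0 ltW.
  apply: (prefix_approx_step (IH (ltnW li)) _ (shallow_map_approx_id C1 nz1 (dlo _ li)) (lip_id _)).
  by move=> M; exists M.
have hi q : (i + q < k)%N -> prefix_approx (i + q) p.
  elim: q => [_|q IH iqk].
    rewrite addn0 -(prednK i0); have li : (i.-1 < i)%N by rewrite prednK.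
    apply: (prefix_approx_step (lo _ li) (F := p)).
    - by move=> M; exists M.
    - rewrite prednK //; apply: shallow_map_approx_of_components di => j.
      exact: shallow_approx_poly n0 Cn nz (pp j).
    - by move=> j; exact: box_lipschitz_poly (pp j).
  rewrite addnS in iqk *.
  apply: (prefix_approx_step (IH (ltnW iqk)) _ (shallow_map_approx_id C1 nz1 _) (lip_id _)).
    exact: poly_map_bounded pp.
  by apply: dhi; rewrite ltnS leq_addr ltnW.
(* The last hidden layer has index [k.-1]; what follows it is the affine output layer. *)
by have := hi (k.-1 - i)%N; rewrite subnKC; [apply; rewrite prednK|]; lia.
Qed.

End Networks.

(** * The norm of column vectors and the passage to compact sets *)

Section Norms.
Variable R : realType.

Lemma norm_le_inbox m (e : R) (v : 'cV[R]_m) : 0 <= e -> inbox e v -> `|v| <= e.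
Proof.
move=> e0 ve; rewrite [leLHS]mx_normrE; apply: bigmax_le => // -[i j] _ /=.
by rewrite (ord1 j).
Qed.

Lemma inbox_norm m (v : 'cV[R]_m) : inbox `|v| v.
Proof.
move=> i; rewrite [leRHS]mx_normrE.
exact: (le_bigmax _ (fun ij : 'I_m * 'I_1 => `|v ij.1 ij.2|) (i, 0)).
Qed.

End Norms.

Theorem theoremD4 (R : realType) (n : nat) (psi : R -> R)
  (d : nat -> nat) (k : nat)
  (p : 'cV[R]_(d 0%N) -> 'cV[R]_(d k)) :
  is_Cn n psi ->
  (exists x, derive1n n psi x != 0) ->
  poly_map_le n p ->
  (forall l, (l <= k)%N -> (0 < d l)%N) ->
  (exists i, [/\ (0 < i < k)%N,
      (d k * ('C(n + d 0, d 0) - d 0) <= d i)%N,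
      (forall l, (l < i)%N -> (d 0 <= d l)%N) &
      (forall l, (i < l <= k)%N -> (d k <= d l)%N)]) ->
  exists thetas : nat -> params R d,
    forall K : set 'cV[R]_(d 0%N), compact K ->
    forall eps : R, 0 < eps ->
    exists N : nat, forall j, (N <= j)%N -> forall x, K x ->
      `| response k psi (thetas j) x - p x | < eps.
Proof.
move=> Cn ex pp dpos [i [/andP[i0 ik] di dlo dhi]].
case: k p Cn pp dpos ik di dhi => [//|k'] p Cn pp dpos ik di dhi.
have [n0|n0] := posnP n.
  (* For [n = 0] all exponents are 0, so [p] is constant and an output layer with zero weights and
     bias [p 0] represents it exactly. *)
  exists (fun=> dfwith (fun=> (0, 0)) k' (0, p 0)) => K _ eps eps0.
  exists 0%N => j _ x _; rewrite /= dfwithin mul0mx add0r.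
  suff -> : p x = p 0 by rewrite subrr normr0.
  apply/colP => l; have [c cE] := pp l; rewrite !cE; apply: eq_bigr => a _.
  congr (_ * _); apply: eq_bigr => q _.
  suff -> : a q = 0%N :> nat by rewrite !expr0.
  by have := ltn_ord (a q); rewrite [in X in (_ < X)%N]n0; case: (a q : nat).
have ha := network_approx n0 Cn ex pp (introT andP (conj i0 ik)) di dlo dhi.
(* The [N]-th network has error at most [1 / (N + 1)] on the box of radius [N]; its read-out becomes
   the output layer. *)
have /choice[th hth] N : exists th : params R d, forall x, inbox N%:R x ->
    inbox N.+1%:R^-1 (response k'.+1 psi th x - p x).
  have [|th [A [c h]]] := ha N%:R N.+1%:R^-1; first by rewrite invr_gt0.
  exists (dfwith th k' (A, c)) => x xN; rewrite /= dfwithin /= (@hidden_ext _ _ _ _ th).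
    exact: h.
  by move=> l lk; rewrite dfwithout // neq_ltn lk orbT.
exists th => K /compact_bounded[M [_ hM]] eps eps0.
(* From here on [j] exceeds [M + 1], so the box of radius [j] contains [K], and also [eps^-1], so
   the error is below [eps]. *)
exists (maxn (Num.truncn (M + 1)).+1 (Num.truncn eps^-1).+1) => j.
rewrite geq_max => /andP[Mj ej] x Kx.
have xj : inbox j%:R x.
  move=> l; rewrite (le_trans (inbox_norm x l)) // (le_trans (hM (M + 1) _ x Kx)) ?ltrDl //.
  by rewrite ltW // (lt_le_trans (truncnS_gt _)) // ler_nat.
rewrite (le_lt_trans (norm_le_inbox _ (hth j x xj))) ?invr_ge0 //.
rewrite invf_plt ?posrE // (lt_le_trans (truncnS_gt _)) // ler_nat.
exact: leq_trans ej (leqnSn _).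
Qed.
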